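(* Let $\Gamma$ be a labeled $\mathbb{Z}^d$-periodic graph and let $\Gamma_a$, with $a\neq0$ real, be a parallel extension of $\Gamma$. Write $BV$ and $BV_a$ for the Bloch varieties of $\Gamma$ and $\Gamma_a$, and let $\pi_a(z_1,\dots,z_d,z_{d+1},\mu)=(z_1,\dots,z_d,\ \mu-a(z_{d+1}+z_{d+1}^{-1}))$. Then: (1) $BV_a=\pi_a^{-1}(BV)$. (2) If $(x,\mu)$ is a critical point of $BV_a$, then $\pi_a(x,\mu)$ is a critical point of $BV$. (3) If $(z,\lambda)$ is a nondegenerate critical point of $BV$, then the critical points of $BV_a$ in the fiber $\pi_a^{-1}(z,\lambda)$ are $(z,\pm1,\lambda\pm2a)$ (same choice of sign in both places). (4) If $(z,\lambda)$ is a degenerate critical point of $BV$, then the fiber $\pi_a^{-1}(z,\lambda)$ consists of degenerate critical points.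
   Context: Let $d>0$ be an integer and $\mathbb{C}^\times$ the nonzero complex numbers. A $\mathbb{Z}^d$-periodic graph $\Gamma$ is a graph with vertex set $\mathcal{V}$ and edge set $\mathcal{E}$, equipped with a free cocompact action of $\mathbb{Z}^d$ (finitely many orbits on $\mathcal{V}$ and on $\mathcal{E}$); the action of $\alpha\in\mathbb{Z}^d$ on $v$ is written $\alpha+v$. $W\subset\mathcal{V}$ is a finite set of orbit representatives. A labeling is a pair $(V,E)$ of $\mathbb{Z}^d$-periodic functions $V\colon\mathcal{V}\to\mathbb{R}$, $E\colon\mathcal{E}\to\mathbb{R}$ (edges undirected). The Floquet matrix $H(z)$, $z=(z_1,\dots,z_d)$, is the $|W|\times|W|$ matrix with $(v,u)$-entry $V(v)\delta_{v,u}+\sum_{(v,\alpha+u)\in\mathcal{E}}E(v,\alpha+u)z^\alpha$, where $z^\alpha=z_1^{\alpha_1}\cdots z_d^{\alpha_d}$. The dispersion polynomial is $D(z,\lambda)=\det(H(z)-\lambda)$; the Bloch variety is $\{(z,\lambda)\in(\mathbb{C}^\times)^d\times\mathbb{C}\mid D(z,\lambda)=0\}$. A critical point of the Bloch variety is a point $(z,\lambda)$ with $D=\partial D/\partial z_1=\dots=\partial D/\partial z_d=0$; it is nondegenerate if the Jacobian matrix of this system of equations is invertible at the point, and degenerate otherwise. Parallel extension: for real $a\ne0$, $\mathbb{Z}_a$ is the infinite path with vertex set $\mathbb{Z}$ and an edge labeled $a$ between $n$ and $n+1$ for each $n\in\mathbb{Z}$. The parallel extension $\Gamma_a=\mathbb{Z}_a\times\Gamma$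 is the product graph, with vertex set $\mathbb{Z}\times\mathcal{V}$, edges $(n,v)\sim(n+1,v)$ labeled $a$ and edges $(n,v)\sim(n,u)$ labeled $E(v,u)$ for $(v,u)\in\mathcal{E}$, and potential $V(n,v)=V(v)$. It is a labeled $\mathbb{Z}^{d+1}$-periodic graph, where the last coordinate of $\mathbb{Z}^{d+1}$ acts by translation on $\mathbb{Z}$. Its Floquet matrix is obtained from $H(z)$ by adding $a(z_{d+1}+z_{d+1}^{-1})$ to each diagonal entry. The map $\pi_a$ is considered as a map $(\mathbb{C}^\times)^{d+1}\times\mathbb{C}\to(\mathbb{C}^\times)^d\times\mathbb{C}$.
   Formalization: Part (4) is false as stated; here it says that all critical points of BV_a in the fiber are degenerate, that the whole fiber is degenerate critical points if ∂D/∂λ=0 at (z,λ), and that otherwise its critical points are exactly (z,±1,λ±2a). *)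

(* Defs.v *)
From HB Require Import structures.
From mathcomp Require Import all_boot all_order all_algebra.
From mathcomp Require Import complex.
From mathcomp Require Import all_classical reals topology normedtype derive.

Set Implicit Arguments.
Unset Strict Implicit.
Unset Printing Implicit Defensive.

Import Order.TTheory GRing.Theory Num.Theory numFieldNormedType.Exports.

Local Open Scope classical_set_scope.
Local Open Scope complex_scope.
Local Open Scope ring_scope.

(* [R[i]] packaged as a numFieldType, so that the normed module structure of  *)
(* a numFieldType over itself, and hence [derive], is inferred.               *)
Definition Cplx (R : realType) : numFieldType := R[i].

(* The edge set is a symmetric relation: [edge v u] means that {v, u} is an   *)
(* edge.  Loops are not excluded.  The finite set W of orbit representatives  *)
(* is enumerated as [rep 0, ..., rep (nreps - 1)], so nreps = |W|.  Freeness  *)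
(* on edges follows from freeness on vertices, as Z^d is torsion-free.        *)
Record periodic_graph (d : nat) : Type := PeriodicGraph {
  vertex : Type;
  edge : vertex -> vertex -> Prop;
  edge_sym : forall v u, edge v u -> edge u v;
  act : 'rV[int]_d -> vertex -> vertex;
  act0 : forall v, act 0 v = v;
  actD : forall al be v, act (al + be) v = act al (act be v);
  act_free : forall al v, act al v = v -> al = 0;
  edge_act : forall al v u, edge v u -> edge (act al v) (act al u);
  nreps : nat;
  rep : 'I_nreps -> vertex;
  rep_cover : forall v, exists i al, v = act al (rep i);
  rep_inj : forall i j al, rep i = act al (rep j) -> i = j;
  (* finitely many orbits of edges, each represented with both orientations   *)
  edge_cofinite : exists (I : finType) (e : I -> vertex * vertex),
    forall v u, edge v u ->
      exists i al, v = act al (e i).1 /\ u = act al (e i).2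
}.

Arguments rep {d} p i.

(* Only the values of [elabel] on edges matter. *)
Record labeling (R : realType) (d : nat) (G : periodic_graph d) : Type :=
  Labeling {
  potential : vertex G -> R;
  elabel : vertex G -> vertex G -> R;
  potential_act : forall al v, potential (act al v) = potential v;
  elabel_sym : forall v u, edge v u -> elabel v u = elabel u v;
  elabel_act : forall al v u, edge v u ->
    elabel (act al v) (act al u) = elabel v u
}.

Section Bloch.
Variables (R : realType) (d : nat).
Local Notation C := (Cplx R).

Definition torus_monomial (z : 'rV[C]_d) (al : 'rV[int]_d) : C :=
  \prod_(i < d) z 0 i ^ al 0 i.

Definition torus_space : set ('rV[C]_d * C) :=
  [set p : 'rV[C]_d * C | forall i, p.1 0 i != 0].

(* The points of C^d x C have coordinates z_1, ..., z_d, lambda. *)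
Definition partial_z (i : 'I_d) (f : 'rV[C]_d * C -> C) (p : 'rV[C]_d * C) : C :=
  'D_(delta_mx 0 i, 0) f p.

Definition partial_lambda (f : 'rV[C]_d * C -> C) (p : 'rV[C]_d * C) : C :=
  'D_(0, 1) f p.

Definition partial (k : 'I_d.+1) : ('rV[C]_d * C -> C) -> 'rV[C]_d * C -> C :=
  if unlift ord_max k is Some i then partial_z i else partial_lambda.

Variables (G : periodic_graph d) (L : labeling R G).

(* The sum is over a finite set, by cocompactness on the edges. *)
Definition floquet (z : 'rV[C]_d) : 'M[C]_(nreps G) :=
  \matrix_(i, j) (((potential L (rep G i))%:C : C) *+ (i == j) +
    \sum_(al \in [set al | edge (rep G i) (act al (rep G j))])
      ((elabel L (rep G i) (act al (rep G j)))%:C : C) * torus_monomial z al).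

Definition dispersion (p : 'rV[C]_d * C) : C :=
  \det (floquet p.1 - p.2%:M).

Definition bloch_variety : set ('rV[C]_d * C) :=
  torus_space `&` [set p | dispersion p = 0].

(* The functions D, dD/dz_1, ..., dD/dz_d, in this order. *)
Definition critical_system (k : 'I_d.+1) : 'rV[C]_d * C -> C :=
  if unlift ord0 k is Some i then partial_z i dispersion else dispersion.

Definition critical_points : set ('rV[C]_d * C) :=
  torus_space `&` [set p | forall k, critical_system k p = 0].

Definition critical_jacobian (p : 'rV[C]_d * C) : 'M[C]_d.+1 :=
  \matrix_(k, l) partial l (critical_system k) p.

Definition nondegenerate_critical_points : set ('rV[C]_d * C) :=
  critical_points `&` [set p | critical_jacobian p \in unitmx].

Definition degenerate_critical_points : set ('rV[C]_d * C) :=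
  critical_points `&` [set p | critical_jacobian p \notin unitmx].

End Bloch.

Definition path_edge (m n : int) : Prop := n = m + 1 \/ m = n + 1.

Section ParallelGraph.
Variables (d : nat) (G : periodic_graph d).

Let pvertex : Type := (int * vertex G)%type.

Definition parallel_edge (p q : pvertex) : Prop :=
  (path_edge p.1 q.1 /\ p.2 = q.2) \/ (p.1 = q.1 /\ edge p.2 q.2).

Definition parallel_act (al : 'rV[int]_(d + 1)) (p : pvertex) : pvertex :=
  (rsubmx al 0 0 + p.1, act (lsubmx al) p.2).

Definition parallel_rep (i : 'I_(nreps G)) : pvertex := (0, rep G i).

Fact parallel_edge_sym p q : parallel_edge p q -> parallel_edge q p.
Proof.
case=> [[[h|h] e]|[h e]].
- by left; split=> //; right.
- by left; split=> //; left.
- by right; split=> //; exact: edge_sym.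
Qed.

Fact parallel_act0 p : parallel_act 0 p = p.
Proof. by case: p => n v; rewrite /parallel_act !linear0 act0 mxE add0r. Qed.

Fact parallel_actD al be p :
  parallel_act (al + be) p = parallel_act al (parallel_act be p).
Proof. by rewrite /parallel_act !linearD /= actD mxE addrA. Qed.

Fact parallel_act_free al p : parallel_act al p = p -> al = 0.
Proof.
case: p => n v [/(congr1 (fun x => x - n)) /=]; rewrite addrK subrr => r0.
move=> /act_free l0; rewrite -[al]hsubmxK l0.
suff -> : rsubmx al = 0 by rewrite row_mx0.
by apply/matrixP => i j; rewrite !ord1 r0 mxE.
Qed.

Fact parallel_edge_act al p q :
  parallel_edge p q -> parallel_edge (parallel_act al p) (parallel_act al q).
Proof.
case=> [[h e]|[h e]]; [left | right]; split=> /=; last exact: edge_act.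
- by case: h => ->; [left | right]; rewrite addrA.
- by rewrite e.
- by rewrite h.
Qed.

Fact parallel_rep_cover p : exists i al, p = parallel_act al (parallel_rep i).
Proof.
case: p => n v; have [i [al ->]] := rep_cover v.
exists i, (row_mx al n%:M); rewrite /parallel_act row_mxKl row_mxKr mxE eqxx.
by rewrite mulr1n addr0.
Qed.

Fact parallel_rep_inj i j al :
  parallel_rep i = parallel_act al (parallel_rep j) -> i = j.
Proof. by case=> _ /rep_inj. Qed.

Fact parallel_edge_cofinite :
  exists (I : finType) (e : I -> pvertex * pvertex),
    forall p q, parallel_edge p q ->
      exists i al, p = parallel_act al (e i).1 /\ q = parallel_act al (e i).2.
Proof.
have [I [e eP]] := edge_cofinite G.
pose f (x : I + 'I_(nreps G) * bool) : pvertex * pvertex := match x with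
  | inl i => ((0, (e i).1), (0, (e i).2))
  | inr (i, b) => ((b%:R, rep G i), ((~~ b)%:R, rep G i)) end.
exists (I + 'I_(nreps G) * bool)%type, f => -[m v] [n u] [] [] /=.
- move=> h; have [i [al ->]] := rep_cover v => <-.
  case: h => /= ->; [exists (inr (i, false)), (row_mx al m%:M)
                    |exists (inr (i, true)), (row_mx al n%:M)];
  by rewrite /parallel_act row_mxKl row_mxKr !mxE eqxx mulr1n /= ?addr0.
- move=> <- /eP[i [al [-> ->]]]; exists (inl i), (row_mx al m%:M).
  by rewrite /parallel_act row_mxKl row_mxKr !mxE eqxx mulr1n /= !addr0.
Qed.

(* Z_a x G; the representatives are {0} x W. *)
Definition parallel_graph : periodic_graph (d + 1) :=
  PeriodicGraph parallel_edge_sym parallel_act0 parallel_actD parallel_act_free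
    parallel_edge_act parallel_rep_cover parallel_rep_inj
    parallel_edge_cofinite.

Variables (R : realType) (L : labeling R G) (a : R).

Definition parallel_potential (p : pvertex) : R := potential L p.2.

Definition parallel_elabel (p q : pvertex) : R :=
  if p.1 == q.1 then elabel L p.2 q.2 else a.

Fact parallel_potential_act al p :
  parallel_potential (parallel_act al p) = parallel_potential p.
Proof. exact: potential_act. Qed.

Fact parallel_elabel_sym p q :
  parallel_edge p q -> parallel_elabel p q = parallel_elabel q p.
Proof.
rewrite /parallel_elabel eq_sym => h; case: eqP => // e.
case: h => [[h _]|[_ h]]; last exact: elabel_sym.
by case: h; rewrite e => /eqP; rewrite -subr_eq0 opprD addNKr.
Qed.

Fact parallel_elabel_act al p q : parallel_edge p q ->
  parallel_elabel (parallel_act al p) (parallel_act al q) = parallel_elabel p q.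
Proof.
rewrite /parallel_elabel /= (inj_eq (addrI _)) => h; case: eqP => // e.
case: h => [[h _]|[_ h]]; last exact: elabel_act.
by case: h; rewrite e => /eqP; rewrite -subr_eq0 opprD addNKr.
Qed.

Definition parallel_labeling : labeling R parallel_graph :=
  @Labeling R _ parallel_graph parallel_potential parallel_elabel
    parallel_potential_act parallel_elabel_sym parallel_elabel_act.

End ParallelGraph.

Section ParallelProj.
Variables (R : realType) (d : nat) (a : R).
Local Notation C := (Cplx R).

(* pi_a, where the coordinate z_(d+1) of x is [rsubmx x 0 0] *)
Definition parallel_proj (q : 'rV[C]_(d + 1) * C) : 'rV[C]_d * C :=
  (lsubmx q.1, q.2 - (a%:C : C) * (rsubmx q.1 0 0 + (rsubmx q.1 0 0)^-1)).

Definition parallel_preimage (A : set ('rV[C]_d * C)) :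
    set ('rV[C]_(d + 1) * C) :=
  @torus_space R (d + 1) `&` parallel_proj @^-1` A.

Definition parallel_fiber (p : 'rV[C]_d * C) : set ('rV[C]_(d + 1) * C) :=
  parallel_preimage [set p].

Definition parallel_pair (p : 'rV[C]_d * C) : set ('rV[C]_(d + 1) * C) :=
  [set (row_mx p.1 1%:M, p.2 + 2 * (a%:C : C));
       (row_mx p.1 (-1)%:M, p.2 - 2 * (a%:C : C))].

End ParallelProj.

(* Main.v *)
(* The projection [pi_a] satisfies [D_a = D o pi_a] identically, where [D] and
   [D_a] are the dispersion polynomials.  Hence [dD_a/dz_i] and [dD_a/dlambda]
   are the corresponding derivatives of [D] composed with [pi_a], and with
   [w = z_(d+1)] one has [dD_a/dw = - a (1 - w^-2) (dD/dlambda o pi_a)].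
   So a point above a critical point [p] of [D] is critical iff
   [dD/dlambda (p) = 0] or [w = 1] or [w = -1].
   If [dD/dlambda (p) = 0], the first row of the Jacobian vanishes at [p] and
   above it.  Otherwise, degeneracy of [p] gives a kernel vector [u] of the
   Hessian in [z_1, ..., z_d], and [(u, 0, 0)] is killed by the Jacobian of
   [D_a] because [dD_a/dw] vanishes on the whole hyperplanes [w = 1] and
   [w = -1]. *)

Require Import Defs.
From mathcomp Require Import all_boot all_order all_algebra.
From mathcomp Require Import complex ring.
From mathcomp Require Import all_classical reals topology normedtype derive.

Set Implicit Arguments.
Unset Strict Implicit.
Unset Printing Implicit Defensive.

Import Order.TTheory GRing.Theory Num.Theory numFieldNormedType.Exports.

Local Open Scope classical_set_scope.
Local Open Scope ring_scope.

(** * Derivatives along lines, finiteness of adjacency, and kernel vectors *)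

Lemma eq_derive_along (K : numFieldType) (V V' W : normedModType K)
    (f : V -> W) (g : V' -> W) (p v : V) (q w : V') :
  (forall h, f (h *: v + p) = g (h *: w + q)) -> 'D_v f p = 'D_w g q.
Proof.
move=> fg; rewrite /derive.
have fgpq : f p = g q by have := fg 0; rewrite !scale0r !add0r.
(* The two difference quotients are the same function of [h], so their limits agree without any
   differentiability assumption. *)
suff -> : (fun h => h^-1 *: ((f \o shift p) (h *: v) - f p)) =
          (fun h => h^-1 *: ((g \o shift q) (h *: w) - g q)) by [].
by apply/funext => h /=; rewrite fg fgpq.
Qed.

Lemma shift_fst (K : pzRingType) (V : lmodType K) (h : K) (u : V) (p : V * K) :
  h *: (u, 0 : K^o) + p = (h *: u + p.1, p.2).
Proof. by rewrite [LHS]surjective_pairing /= scaler0 add0r. Qed.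

Lemma shift_snd (K : pzRingType) (V : lmodType K) (h : K) (p : V * K) :
  h *: (0, 1 : K^o) + p = (p.1, h + p.2).
Proof.
by rewrite [LHS]surjective_pairing /= scaler0 add0r /GRing.scale /= mulr1.
Qed.

(** The one chain rule in the proof; induction on [P] through [P * 'X + c] reduces it to the product
    rule. *)
Lemma is_derive_horner_comp (K : numFieldType) (P : {poly K}) (g : K -> K)
    (x dg : K) : is_derive x (1 : K) g dg ->
  is_derive x (1 : K) (fun t => P.[g t]) (P^`().[g x] * dg).
Proof.
move=> dgx; elim/poly_ind: P => [|P c IH].
  rewrite deriv0 horner0 mul0r.
  have -> : (fun t => (0 : {poly K}).[g t]) = cst 0.
    by apply/funext => t; rewrite horner0.
  exact: is_derive_cst.
have -> : (fun t => (P * 'X + c%:P).[g t]) = (fun t => P.[g t]) * g + cst c.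
  by apply/funext => t; rewrite !hornerE !fctE.
apply: is_derive_eq; rewrite derivD derivC addr0 derivM derivX mulr1 addr0.
by rewrite hornerD hornerM hornerX /GRing.scale /=; ring.
Qed.

Lemma is_derive_add_inv (K : numFieldType) (w : K) : w != 0 ->
  is_derive w (1 : K) (fun t => t + t^-1) (1 - w^-2).
Proof.
move=> w0; have dV : is_derive w (1 : K) (fun t : K => t^-1) (- w^-2).
  apply: DeriveDef; first exact: (@derivableV K K id).
  by rewrite (@deriveV K K id) // derive_id /GRing.scale /= mulr1.
exact: (@is_deriveD _ _ _ id).
Qed.

(** By freeness, each of the finitely many edge orbits contributes at most one [al]: its first
    endpoint fixes the translation [be], and its second endpoint then fixes [al]. Finiteness matters
    because a sum over an infinite support defaults to 0. *)
Lemma finite_adjacent (d : nat) (G : periodic_graph d) (v u : vertex G) :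
  finite_set [set al | edge v (act al u)].
Proof.
have [I [e eP]] := edge_cofinite G.
pose P (k : I) (al : 'rV[int]_d) :=
  exists be, v = act be (e k).1 /\ act al u = act be (e k).2.
(* The default 0 is harmless: [f k] is only used when some [al] satisfies [P k]. *)
pose f (k : I) : 'rV[int]_d := xget 0 [set al | P k al].
apply: (@sub_finite_set _ _ (f @` [set: I])); last first.
  by apply: finite_image; exact: finite_finset.
move=> al /eP [k Pk]; exists k => //.
have [be' [vb' ab']] : P k (f k).
  by apply: (@xgetPex _ 0 [set al | P k al]); exists al.
case: Pk => be [vb ab].
have ebe : be' = be.
  apply/eqP; rewrite -subr_eq0; apply/eqP.
  apply: (@act_free _ G _ (act be (e k).1)).
  by rewrite -actD subrK -vb' vb.
rewrite ebe in ab'; apply/eqP; rewrite -subr_eq0; apply/eqP.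
by apply: (@act_free _ G _ (act al u)); rewrite -actD subrK ab'.
Qed.

Lemma torus_monomial_split (R : realType) (d : nat) (x : 'rV[Cplx R]_(d + 1))
    (al : 'rV[int]_(d + 1)) :
  torus_monomial x al =
  torus_monomial (lsubmx x) (lsubmx al) * rsubmx x 0 0 ^ rsubmx al 0 0.
Proof.
rewrite /torus_monomial big_split_ord big_ord1 !mxE; congr (_ * _).
by apply: eq_bigr => i _; rewrite !mxE.
Qed.

Lemma torus_monomial0 (R : realType) (d : nat) (z : 'rV[Cplx R]_d) :
  torus_monomial z 0 = 1.
Proof. by rewrite /torus_monomial big1 // => i _; rewrite mxE. Qed.

Lemma non_unitmxP (F : fieldType) (n : nat) (A : 'M[F]_n) :
  reflect (exists2 v : 'cV_n, v != 0 & A *m v = 0) (A \notin unitmx).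
Proof.
rewrite unitmxE unitfE negbK -det_tr; apply: (iffP det0P) => -[v v0 e].
  by exists v^T; rewrite ?trmx_eq0 // -[A]trmxK -trmx_mul e trmx0.
by exists v^T; rewrite ?trmx_eq0 // -trmx_mul e trmx0.
Qed.

(** * Critical points and the Jacobian of one Bloch variety *)

Section Bloch.
Variables (R : realType) (d : nat) (G : periodic_graph d) (L : labeling R G).
Local Notation C := (Cplx R).

(** The characteristic polynomial of the Floquet matrix up to sign; it exhibits [D] as a polynomial
    in lambda, hence differentiable there. *)
Definition dispersion_poly (z : 'rV[C]_d) : {poly C} :=
  \det (map_mx polyC (floquet L z) - 'X%:M).

Lemma horner_dispersion_poly (z : 'rV[C]_d) (lam : C) :
  (dispersion_poly z).[lam] = dispersion L (z, lam).
Proof.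
rewrite /dispersion /dispersion_poly /= -horner_evalE -det_map_mx.
congr (\det _); apply/matrixP => i j; rewrite !mxE /= /horner_eval.
by rewrite hornerD hornerN hornerC hornerMn hornerX.
Qed.

Lemma partial_lambda_dispersion (p : 'rV[C]_d * C) :
  partial_lambda (dispersion L) p = (dispersion_poly p.1)^`().[p.2].
Proof.
case: p => z lam /=.
rewrite /partial_lambda (@eq_derive_along C _ C^o C^o _
  (horner (dispersion_poly z)) _ _ lam 1); last first.
  by move=> h; rewrite shift_snd -horner_dispersion_poly /GRing.scale /= mulr1.
rewrite -[RHS]mulr1.
exact: (@derive_val _ _ _ _ _ _ _
  (is_derive_horner_comp _ (is_derive_id _ _))).
Qed.

Lemma critical_system0 : critical_system L ord0 = dispersion L.
Proof. by rewrite /critical_system unlift_none. Qed.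

Lemma critical_systemS (i : 'I_d) :
  critical_system L (lift ord0 i) = partial_z i (dispersion L).
Proof. by rewrite /critical_system liftK. Qed.

Lemma partial_max : @partial R d ord_max = @partial_lambda R d.
Proof. by rewrite /partial unlift_none. Qed.

Lemma partial_lift (i : 'I_d) : partial (lift ord_max i) = @partial_z R d i.
Proof. by rewrite /partial liftK. Qed.

Lemma critical_pointsP (p : 'rV[C]_d * C) :
  critical_points L p <-> [/\ torus_space p, dispersion L p = 0 &
    forall i, partial_z i (dispersion L) p = 0].
Proof.
split=> [[tp cp]|[tp D0 dD]]; last first.
  split=> // k; case: (unliftP ord0 k) => [i|] ->.
    by rewrite critical_systemS.
  by rewrite critical_system0.
split=> // [|i]; first by rewrite -critical_system0; exact: cp.
by rewrite -critical_systemS; exact: cp.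
Qed.

(** Lambda is the last column ([ord_max]) whereas [D] is the first row ([ord0]), so rows and columns
    of the Jacobian are split at opposite ends. *)
Lemma critical_jacobian_mulE (p : 'rV[C]_d * C) (v : 'cV[C]_d.+1)
    (k : 'I_d.+1) :
  (critical_jacobian L p *m v) k 0 =
  partial_lambda (critical_system L k) p * v ord_max 0 +
  \sum_(i < d) partial_z i (critical_system L k) p * v (lift ord_max i) 0.
Proof.
rewrite mxE (bigD1_ord ord_max) //= !mxE partial_max; congr (_ + _).
by apply: eq_bigr => i _; rewrite !mxE partial_lift.
Qed.

Lemma critical_jacobian_singular (p : 'rV[C]_d * C) :
  critical_points L p -> partial_lambda (dispersion L) p = 0 ->
  critical_jacobian L p \notin unitmx.
Proof.
move=> /critical_pointsP[_ _ dD] dl; rewrite -unitmx_tr; apply/non_unitmxP.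
(* This vector selects the row of [D], which is its gradient and vanishes here. *)
exists (delta_mx ord0 0).
  apply/eqP => /matrixP/(_ ord0 0) /eqP; by rewrite !mxE !eqxx oner_eq0.
apply/matrixP => l j; rewrite !mxE (bigD1 ord0) //= big1.
  rewrite addr0 !mxE critical_system0; case: (unliftP ord_max l) => [i|] ->.
    by rewrite partial_lift dD mul0r.
  by rewrite partial_max dl mul0r.
by move=> k k0; rewrite !mxE (negPf k0) mulr0.
Qed.

(** At a critical point the row of [D] is zero outside the lambda column, so it forces a kernel
    vector to have lambda component 0; the rest of that vector is [u]. *)
Lemma degenerate_critical_hessian (p : 'rV[C]_d * C) :
  degenerate_critical_points L p -> partial_lambda (dispersion L) p != 0 ->
  exists2 u : 'rV[C]_d, u != 0 &
    forall k, \sum_(i < d) partial_z i (critical_system L k) p * u 0 i = 0.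
Proof.
move=> [/critical_pointsP[_ _ dD] /non_unitmxP[v v0 Jv]] dl.
have Jvk k := critical_jacobian_mulE p v k.
have vmax : v ord_max 0 = 0.
  have := Jvk ord0; rewrite Jv mxE critical_system0 big1 ?addr0.
    by move=> /esym/eqP; rewrite mulf_eq0 (negPf dl) => /eqP.
  by move=> i _; rewrite dD mul0r.
exists (\row_i v (lift ord_max i) 0).
  apply: contra_neq v0 => u0; apply/matrixP => l j; rewrite ord1 mxE.
  case: (unliftP ord_max l) => [i|] -> //.
  by move/rowP: u0 => /(_ i); rewrite !mxE.
move=> k; have := Jvk k.
rewrite Jv [X in X = _]mxE vmax [X in X + _]mulr0 add0r => S0.
by apply: etrans (esym S0); apply: eq_bigr => i _; rewrite mxE.
Qed.

End Bloch.

(** * The Floquet matrix, dispersion polynomial and critical points of the extension *)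

Section ParallelExtension.
Variables (R : realType) (d : nat) (G : periodic_graph d) (L : labeling R G).
Variable a : R.
Local Notation C := (Cplx R).
Local Notation La := (parallel_labeling L a).

Lemma floquet_parallel (x : 'rV[C]_(d + 1)) :
  floquet La x = floquet L (lsubmx x) +
    ((a%:C%C : C) * (rsubmx x 0 0 + (rsubmx x 0 0)^-1))%:M.
Proof.
apply/matrixP => i j; rewrite !mxE -addrA; congr (_ + _).
pose lft (be : 'rV[int]_d) (n : int) : 'rV[int]_(d + 1) := row_mx be n%:M.
have lftE al : al = lft (lsubmx al) (rsubmx al 0 0).
  by rewrite /lft -mx11_scalar hsubmxK.
have lftl be n : lsubmx (lft be n) = be by rewrite row_mxKl.
have lftr be n : rsubmx (lft be n) 0 0 = n by rewrite row_mxKr mxE eqxx.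
pose E := [set be | edge (rep G i) (act be (rep G j))].
pose P := [set al : 'rV[int]_(d + 1) |
  i = j /\ (al = lft 0 1 \/ al = lft 0 (-1))].
have finE : finite_set E by exact: finite_adjacent.
have finP : finite_set P.
  apply: (@sub_finite_set _ _ [set lft 0 1; lft 0 (-1)]).
    by move=> al [_].
  exact: finite_set2.
(* Neighbours split by last coordinate: 0 for edges of the base graph, 1 or -1 for path edges. A
   path edge keeps the base vertex, so [rep_inj] gives [i = j] and freeness kills the first [d]
   coordinates. *)
have -> : [set al | @edge _ (parallel_graph G) (rep (parallel_graph G) i)
    (act al (rep (parallel_graph G) j))] = (lft^~ 0 @` E) `|` P.
  apply/seteqP; split=> al /=.
  - rewrite /parallel_edge /= addr0 /path_edge => -[[h e]|[h e]].
      right; have ij := rep_inj e; split=> //; subst j.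
      have l0 : lsubmx al = 0 by apply: (act_free (esym e)).
      rewrite (lftE al) l0; case: h => h; [left|right].
        by rewrite h add0r.
      by congr lft; apply/eqP; rewrite -subr_eq0 opprK -h.
    by left; exists (lsubmx al) => //; rewrite [RHS]lftE -h.
  - rewrite /parallel_edge /= addr0 /path_edge => -[[be Eb <-]|[ij]].
      by right; rewrite lftl lftr.
    subst j; case=> ->; left; rewrite lftl lftr act0; split=> //.
      by left.
    by right; rewrite addNr.
rewrite fsbigU //=; last first.
- move=> al [[be _ <-] [_]] [] /(congr1 (fun y => rsubmx y 0 0)).
    by rewrite !lftr.
  by rewrite !lftr.
- exact: finite_image.
congr (_ + _).
  rewrite fsbig_image; last first.
    by move=> be be' _ _ /(congr1 lsubmx); rewrite !lftl.
  apply: eq_fsbigr => be _; rewrite torus_monomial_split lftl lftr expr0z mulr1.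
  by rewrite /= /parallel_elabel /= lftr addr0 eqxx lftl.
case: eqVneq => [ij|nij]; last first.
  rewrite mulr0n fsbig1 // => al [ij]; by rewrite ij eqxx in nij.
subst j; have -> : P = [set lft 0 1] `|` [set lft 0 (-1)].
  by apply/seteqP; split=> [al [_ h] //|al h]; split.
rewrite fsbigU //=; last first.
  by move=> al [/= -> /(congr1 (fun y => rsubmx y 0 0))]; rewrite !lftr.
rewrite !fsbig_set1 !torus_monomial_split !lftl !lftr !torus_monomial0 !mul1r.
by rewrite /parallel_elabel /= !lftr !addr0 /= expr1z exprN1 -mulrDr mulr1n
  !mxE.
Qed.

(** The scalar matrix added to the Floquet matrix is absorbed into the shift of lambda made by
    [parallel_proj]. *)
Lemma dispersion_parallel (q : 'rV[C]_(d + 1) * C) :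
  dispersion La q = dispersion L (parallel_proj a q).
Proof.
rewrite /dispersion floquet_parallel /= -addrA; congr (\det (_ + _)).
by rewrite -!raddfN -raddfD /= opprB.
Qed.

(** The projection carries a line in direction [z_i] to such a line with the same parameter. As [f]
    is arbitrary, this also serves for second derivatives. *)
Lemma partial_z_lshift_proj (f : 'rV[C]_d * C -> C) (i : 'I_d)
    (q : 'rV[C]_(d + 1) * C) :
  partial_z (lshift 1 i) (f \o parallel_proj a) q =
  partial_z i f (parallel_proj a q).
Proof.
apply: eq_derive_along => h.
rewrite !shift_fst /parallel_proj /=; congr (f (_, _)).
  by apply/rowP => j; rewrite !mxE !eqxx (inj_eq (@lshift_inj _ _)).
by rewrite !mxE !eqxx eq_rlshift mulr0 add0r.
Qed.

Lemma partial_lambda_proj (f : 'rV[C]_d * C -> C) (q : 'rV[C]_(d + 1) * C) :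
  partial_lambda (f \o parallel_proj a) q =
  partial_lambda f (parallel_proj a q).
Proof.
apply: eq_derive_along => h.
by rewrite !shift_snd /parallel_proj /= addrA.
Qed.

Lemma dispersion_parallelE :
  dispersion La = dispersion L \o parallel_proj a :> ('rV[C]_(d + 1) * C -> C).
Proof. by apply/funext => q; exact: dispersion_parallel. Qed.

(** The derivative in [w] of the lambda coordinate of [parallel_proj], for nonzero [w]. *)
Definition proj_slope (w : C) : C := - (a%:C%C : C) * (1 - w^-2).

(** Moving [w] alone fixes the first [d] coordinates of the projection, so the chain rule is only
    needed for the polynomial in lambda. *)
Lemma partial_z_rshift_dispersion (q : 'rV[C]_(d + 1) * C) :
  rsubmx q.1 0 0 != 0 ->
  partial_z (rshift d 0) (dispersion La) q =
  partial_lambda (dispersion L) (parallel_proj a q) *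
    proj_slope (rsubmx q.1 0 0).
Proof.
case: q => x mu /= w0; set w := rsubmx x 0 0 in w0 *.
pose g (t : C) : C := mu - (a%:C%C : C) * (t + t^-1).
rewrite partial_lambda_dispersion /=.
rewrite /partial_z (@eq_derive_along C _ C^o C^o _
  (fun t => (dispersion_poly L (lsubmx x)).[g t]) _ _ w 1); last first.
  move=> h; rewrite shift_fst horner_dispersion_poly dispersion_parallel.
  rewrite /parallel_proj /=.
  have -> : lsubmx (h *: delta_mx 0 (rshift d 0) + x) = lsubmx x.
    by apply/rowP => j; rewrite !mxE eq_lrshift andbF mulr0 add0r.
  have -> : rsubmx (h *: delta_mx 0 (rshift d 0) + x) 0 0 = h *: (1 : C^o) + w.
    by rewrite /w !mxE !eqxx.
  by [].
have dg : is_derive w (1 : C) g (proj_slope w).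
  apply: (is_derive_eq (is_deriveB (is_derive_cst mu w 1)
    (is_deriveZ (a%:C%C : C) (is_derive_add_inv w0)))).
  rewrite /proj_slope mulNr.
  exact: sub0r.
exact: (@derive_val _ _ _ _ _ _ _ (is_derive_horner_comp _ dg)).
Qed.

Lemma torus_rsubmx (q : 'rV[C]_(d + 1) * C) : torus_space q ->
  rsubmx q.1 0 0 != 0.
Proof. by move=> tq; rewrite mxE; exact: tq. Qed.

Lemma torus_proj (q : 'rV[C]_(d + 1) * C) : torus_space q ->
  torus_space (parallel_proj a q).
Proof. by move=> tq i /=; rewrite mxE; exact: tq. Qed.

Lemma critical_points_parallelP (q : 'rV[C]_(d + 1) * C) :
  critical_points La q <-> [/\ torus_space q,
    critical_points L (parallel_proj a q) &
    partial_lambda (dispersion L) (parallel_proj a q) *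
      proj_slope (rsubmx q.1 0 0) = 0].
Proof.
split.
  move=> /critical_pointsP[tq D0 dD]; split=> //.
    apply/critical_pointsP; split; first exact: torus_proj.
      by rewrite -dispersion_parallel.
    move=> i; rewrite -partial_z_lshift_proj -dispersion_parallelE.
    exact: dD.
  by rewrite -partial_z_rshift_dispersion ?dD //; exact: torus_rsubmx.
move=> [tq /critical_pointsP[_ D0 dD] sl]; apply/critical_pointsP; split=> //.
  by rewrite dispersion_parallel.
move=> i; rewrite -(splitK i); case: (fintype.split i) => j /=.
  by rewrite dispersion_parallelE partial_z_lshift_proj.
by rewrite ord1 partial_z_rshift_dispersion //; exact: torus_rsubmx.
Qed.

(** * Fibers of the projection and degeneracy of their critical points *)

Hypothesis a0 : a != 0.

Lemma proj_slope_eq0 (w : C) : w != 0 ->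
  (proj_slope w == 0) = (w == 1) || (w == -1).
Proof.
move=> w0; rewrite mulf_eq0 oppr_eq0.
rewrite (@fmorph_eq0 _ _ (real_complex R)) (negPf a0) /=.
by rewrite subr_eq0 eq_sym invr_eq1 sqrf_eq1.
Qed.

(** The coordinate [w] parametrizes the fiber, since it determines [mu] from lambda. *)
Lemma parallel_fiberP (p : 'rV[C]_d * C) (q : 'rV[C]_(d + 1) * C) (w : C) :
  torus_space p -> w != 0 -> rsubmx q.1 0 0 = w ->
  parallel_fiber a p q <->
  q = (row_mx p.1 w%:M, p.2 + (a%:C%C : C) * (w + w^-1)).
Proof.
case: p q => z lam [x mu] /= tp w0 xw; split=> [[_ /= [zx lamx]]|[xE muE]].
  congr (_, _); last by rewrite -lamx xw subrK.
  by rewrite -[LHS]hsubmxK zx -xw -mx11_scalar.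
split=> [i /=|]; last by rewrite /= /parallel_proj /= xw xE muE row_mxKl addrK.
rewrite xE mxE; case: (fintype.split i) => j; first exact: tp.
by rewrite ord1 mxE.
Qed.

(** The slope vanishes only at [w = 1] and [w = -1], where [w + w^-1] equals 2 and -2. *)
Lemma parallel_pairP (p : 'rV[C]_d * C) (q : 'rV[C]_(d + 1) * C) :
  torus_space p -> parallel_pair a p q <->
  parallel_fiber a p q /\ proj_slope (rsubmx q.1 0 0) = 0.
Proof.
move=> tp.
have n1 : (-1 : C) != 0 by rewrite oppr_eq0 oner_eq0.
have eP : p.2 + 2 * (a%:C%C : C) = p.2 + (a%:C%C : C) * (1 + 1^-1).
  by rewrite invr1 mulrC.
have eN : p.2 - 2 * (a%:C%C : C) = p.2 + (a%:C%C : C) * (-1 + (-1)^-1).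
  by rewrite invrN1 -opprD mulrN mulrC.
rewrite /parallel_pair eP eN; split.
  case=> /= qE; have wE := congr1 (fun y => rsubmx y.1 0 0) qE;
    rewrite /= row_mxKr [RHS]mxE eqxx mulr1n in wE.
    split; first by apply/(parallel_fiberP tp (oner_neq0 _) wE).
    by apply/eqP; rewrite wE proj_slope_eq0 ?oner_eq0 ?eqxx.
  split; first by apply/(parallel_fiberP tp n1 wE).
  by apply/eqP; rewrite wE proj_slope_eq0 ?eqxx ?orbT.
move=> [fq /eqP]; rewrite proj_slope_eq0 ?torus_rsubmx //; last by case: fq.
case/orP => /eqP wE; [left|right].
  exact: (parallel_fiberP tp (oner_neq0 _) wE).1.
exact: (parallel_fiberP tp n1 wE).1.
Qed.

Lemma critical_fiber_pair (p : 'rV[C]_d * C) :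
  critical_points L p -> partial_lambda (dispersion L) p != 0 ->
  critical_points La `&` parallel_fiber a p = parallel_pair a p.
Proof.
move=> cp dl; have tp : torus_space p by case: cp.
apply/seteqP; split=> q.
  move=> [/critical_points_parallelP[_ _ sl] fq].
  apply/parallel_pairP => //; split=> //.
  case: fq => _ /= pq; move/eqP: sl.
  by rewrite pq mulf_eq0 (negPf dl) => /eqP.
move=> /(parallel_pairP _ tp)[fq sl]; split=> //.
case: fq => tq /= pq.
by apply/critical_points_parallelP; split; rewrite ?pq // sl mulr0.
Qed.

Lemma degenerate_fiber (p : 'rV[C]_d * C) : degenerate_critical_points L p ->
  critical_points La `&` parallel_fiber a p `<=` degenerate_critical_points La.
Proof.
move=> dp q [cq [tq /= pq]]; split=> //=.
have [dl0|dl] := eqVneq (partial_lambda (dispersion L) p) 0.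
  apply: (critical_jacobian_singular cq).
  by rewrite dispersion_parallelE partial_lambda_proj pq dl0.
have sl : proj_slope (rsubmx q.1 0 0) = 0.
  have [_ _ /eqP] := (critical_points_parallelP q).1 cq.
  by rewrite pq mulf_eq0 (negPf dl) => /eqP.
have [u u0 Hu] := degenerate_critical_hessian dp dl.
(* The vector [u] extended by 0 in the [w] and lambda coordinates. *)
pose v : 'cV[C]_(d + 1).+1 :=
  \col_l oapp (fun j => row_mx u (0 : 'rV_1) 0 j) 0 (unlift ord_max l).
apply/non_unitmxP; exists v.
  apply: contra_neq u0 => /matrixP v0; apply/rowP => i.
  by have := v0 (lift ord_max (lshift 1 i)) 0; rewrite !mxE liftK /= row_mxEl.
apply/matrixP => k j; rewrite ord1 critical_jacobian_mulE !mxE unlift_none /=.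
rewrite [X in X + _]mulr0 add0r big_split_ord big_ord1.
rewrite !mxE liftK /= row_mxEr mxE.
rewrite [X in _ + X]mulr0 addr0.
under eq_bigr => i _ do rewrite mxE liftK /= row_mxEl.
(* The rows of [D_a] and of its first [d] derivatives reduce to rows of [D] at [p], killed by [u];
   the row of the [w] derivative is treated last. *)
case: (unliftP ord0 k) => [l|] ->; last first.
  rewrite critical_system0 dispersion_parallelE -[RHS](Hu ord0).
  by apply: eq_bigr => i _; rewrite partial_z_lshift_proj pq critical_system0.
rewrite critical_systemS -(splitK l); case: (fintype.split l) => m /=.
  rewrite -[RHS](Hu (lift ord0 m)) dispersion_parallelE.
  have -> : partial_z (lshift 1 m) (dispersion L \o parallel_proj a) =
      partial_z m (dispersion L) \o parallel_proj a.
    by apply/funext => y; exact: partial_z_lshift_proj.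
  by apply: eq_bigr => i _; rewrite partial_z_lshift_proj pq critical_systemS.
rewrite big1 // => i _; rewrite ord1.
suff -> : partial_z (lshift 1 i) (partial_z (rshift d 0) (dispersion La)) q = 0.
  by rewrite mul0r.
rewrite /partial_z.
rewrite (@eq_derive_along _ _ C^o C^o _ (cst 0) _ _ 0 1) ?derive_cst // => h.
(* Along this line [w] keeps its value, where the slope is 0. The formula for the [w] derivative
   asks only that [w] be nonzero, so it holds on the whole line. *)
have qw : rsubmx (h *: (delta_mx 0 (lshift 1 i), 0) + q).1 0 0 = rsubmx q.1 0 0.
  by rewrite !mxE eq_rlshift andbF mulr0 add0r.
rewrite -/(partial_z _ _ _) partial_z_rshift_dispersion qw ?torus_rsubmx //.
by rewrite sl mulr0.
Qed.

End ParallelExtension.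

(** Clause (4) splits on the lambda derivative of [D] at [p]: if it vanishes, the whole fiber is
    critical and degenerate; otherwise only the two points with [w = 1] or [w = -1] are critical,
    and those are degenerate. *)
Theorem theorem4p2 (R : realType) (d : nat) (G : periodic_graph d)
    (L : labeling R G) (a : R) (hd : (0 < d)%N) (ha : a != 0) :
  [/\ bloch_variety (parallel_labeling L a)
        = parallel_preimage a (bloch_variety L),
      forall q, critical_points (parallel_labeling L a) q ->
        critical_points L (parallel_proj a q),
      forall p, nondegenerate_critical_points L p ->
        critical_points (parallel_labeling L a) `&` parallel_fiber a p
          = parallel_pair a p
    & forall p, degenerate_critical_points L p ->
        [/\ critical_points (parallel_labeling L a) `&` parallel_fiber a p
              `<=` degenerate_critical_points (parallel_labeling L a),
            partial_lambda (dispersion L) p = 0 ->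
              parallel_fiber a p
                `<=` degenerate_critical_points (parallel_labeling L a)
          & partial_lambda (dispersion L) p != 0 ->
              critical_points (parallel_labeling L a) `&` parallel_fiber a p
                = parallel_pair a p]].
Proof.
split.
- apply/seteqP; split=> q [tq /= Dq]; split=> //=.
    by split; [exact: torus_proj|rewrite /= -dispersion_parallel].
  by case: Dq => _ /=; rewrite -dispersion_parallel.
- by move=> q /critical_points_parallelP[].
- move=> p [cp /= Jp]; apply: critical_fiber_pair => //.
  (* Nondegeneracy rules out a vanishing lambda derivative, which would make the Jacobian
     singular. *)
  by apply: contraTneq Jp => dl; exact: critical_jacobian_singular.
- move=> p dp; have [cp _] := dp; split.
  + exact: degenerate_fiber.
  + move=> dl q fq; apply: (degenerate_fiber dp); split=> //.
    case: fq => tq /= pq.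
    by apply/critical_points_parallelP; split; rewrite ?pq // dl mul0r.
  + exact: critical_fiber_pair.
Qed.
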